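(* Let $\mathbb{A}$ be a Stone algebra. Then the closed unit ball $\mathrm{B}_{\mathbb{A}}[0;1]=\{f\in\mathbb{A}\mid |f|\le\mathbf{1}\}$ is uniformly totally order-bounded. More generally, let $E$ be a Kaplansky–Hilbert module of finite rank over $\mathbb{A}$. For $M\subseteq E$ the following assertions are equivalent: (i) $M$ is order-bounded. (ii) $M$ is totally order-bounded. (iii) $M$ is uniformly totally order-bounded.
   Context: A Stone algebra is a commutative unital $C^*$-algebra $\mathbb{A}$ (unit $\mathbf{1}$) that is Dedekind complete as a Banach lattice; equivalently $\mathbb{A}\cong \mathrm{C}(\Omega)$ with $\Omega$ compact Hausdorff and extremally disconnected. Infima and suprema are taken in its self-adjoint part; $\mathbb{A}_+$ is the positive cone. A lattice-normed space over $\mathbb{A}$ is a complex vector space $E$ with a map $|\cdot|\colon E\to\mathbb{A}_+$ satisfying $|x|=0\Leftrightarrow x=0$, $|\lambda x|=|\lambda||x|$ ($\lambda\in\mathbb{C}$) and $|x+y|\le|x|+|y|$. $\mathbb{A}$ is lattice-normed over itself via its modulus. A lattice-normed module is a lattice-normed space that is an $\mathbb{A}$-module (bilinear multiplication) with $|\lambda x|=|\lambda||x|$ for $\lambda\in\mathbb{A}$. A pre-Hilbert lattice-normed module has in addition an $\mathbb{A}$-sesquilinear map $(\cdot|\cdot)\colon E\times E\to\mathbb{A}$ with $(x|x)=|x|^2$. A net $(x_\alpha)_\alpha$ in $E$ order-converges to $x$ if there is a net $(u_i)_i$ in $\mathbb{A}_+$, decreasing with infimum $0$, such that for each $i$ there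 is $\alpha_i$ with $|x_\alpha-x|\le u_i$ for all $\alpha\ge\alpha_i$. It is order-Cauchy if $(|x_\alpha-x_\beta|)_{(\alpha,\beta)}$ order-converges to $0$ in $\mathbb{A}$; $E$ is order-complete if every order-Cauchy net order-converges. A Kaplansky–Hilbert (KH-)module is an order-complete pre-Hilbert lattice-normed module over a Stone algebra. It has finite rank if it has a finite suborthonormal basis: elements $e_1,\dots,e_d\in E$ with $(e_i|e_j)=0$ for $i\neq j$, each $|e_j|$ idempotent, and $x=\sum_{j=1}^d(x|e_j)e_j$ for all $x\in E$ (equivalently, $E$ is finitely generated as an $\mathbb{A}$-module). A subset $M\subseteq E$ is order-bounded if there is $f\in\mathbb{A}_+$ with $|x|\le f$ for all $x\in M$. $M$ is totally order-bounded if there is a net $(u_\alpha)_\alpha$ in $\mathbb{A}_+$, decreasing with infimum $0$, such that for every $\alpha$ there is a finite $F\subseteq E$ with $\inf_{y\in F}|x-y|\le u_\alpha$ for every $x\in M$. $M$ is uniformly totally order-bounded if for every real $\varepsilon>0$ there is a finite $F\subseteq E$ with $\inf_{y\in F}|x-y|\le\varepsilon\mathbf{1}$ for every $x\in M$. *)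

(* Defs.v *)
From HB Require Import structures.
From mathcomp Require Import all_boot all_order all_algebra.
From mathcomp Require Import complex.
From mathcomp Require Import boolp classical_sets cardinality reals.

Set Implicit Arguments.
Unset Strict Implicit.
Unset Printing Implicit Defensive.

Import Order.TTheory GRing.Theory Num.Theory.

Local Open Scope classical_set_scope.
Local Open Scope ring_scope.

(* The complex algebra structure is given by its structure map
   [cscal : c |-> c 1], so that the scalar multiple of [a] by [c] is
   [cscal c * a].  Over a [comPzRingType], this does not exclude the zero algebra
   (the functions on the empty space), as [comAlgType R[i]] would.  The norm is
   a field because Hierarchy-Builder does not admit the join of
   [completeNormedModType] with ring structures. *)
HB.mixin Record isComCStarAlgebra (R : realType) A of GRing.ComPzRing A := {
  cscal : {rmorphism R[i] -> A};
  star : A -> A;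
  cnorm : A -> R;
  starK : forall a, star (star a) = a;
  starD : forall a b, star (a + b) = star a + star b;
  starM : forall a b, star (a * b) = star b * star a;
  star_cscal : forall c : R[i], star (cscal c) = cscal (c^*)%C;
  cnorm_eq0 : forall a, cnorm a = 0 -> a = 0;
  cnormD : forall a b, cnorm (a + b) <= cnorm a + cnorm b;
  cnormZ : forall (c : R[i]) a,
    cnorm (cscal c * a) = Normc.normc c * cnorm a;
  cnormM : forall a b, cnorm (a * b) <= cnorm a * cnorm b;
  cnorm_star : forall a, cnorm (star a * a) = cnorm a ^+ 2;
  cnorm_complete : forall u : nat -> A,
    (forall e : R, 0 < e -> exists N, forall m n : nat,
       (N <= m)%N -> (N <= n)%N -> cnorm (u m - u n) < e) ->
    exists l, forall e : R, 0 < e -> exists N, forall n : nat,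
       (N <= n)%N -> cnorm (u n - l) < e
}.

#[short(type="comCStarAlgType")]
HB.structure Definition ComCStarAlgebra (R : realType) :=
  {A of GRing.ComPzRing A & isComCStarAlgebra R A}.

Section Order.
Context {R : realType} {A : comCStarAlgType R}.
Implicit Types (a b g : A) (S : set A).

Definition selfadjoint : set A := [set a | star a = a].

Definition pos_cone : set A := [set a | exists b, a = star b * b].

Definition cle a b : Prop := pos_cone (b - a).

(* The unique positive square root of [star a * a]; the default value of
   [xget] is never used since such a root always exists. *)
Definition modulus a : A :=
  xget 0 [set b | pos_cone b /\ b ^+ 2 = star a * a].

Definition is_inf S g : Prop :=
  [/\ selfadjoint g,
      forall a, S a -> cle g a &
      forall b, selfadjoint b -> (forall a, S a -> cle b a) -> cle b g].

Definition is_sup S g : Prop :=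
  [/\ selfadjoint g,
      forall a, S a -> cle a g &
      forall b, selfadjoint b -> (forall a, S a -> cle a b) -> cle g b].

End Order.

(* Dedekind completeness of the real Banach lattice [selfadjoint]. *)
Definition stone_algebra (R : realType) (A : comCStarAlgType R) : Prop :=
  forall S : set A, S `<=` selfadjoint -> S !=set0 ->
    (exists2 b, selfadjoint b & forall a, S a -> cle a b) ->
    exists g, is_sup S g.

(* The complex vector space structure of [E] is not a separate datum: as the
   multiplication is C-bilinear and the algebra is unital, the scalar multiple
   of [x] by [c : R[i]] is necessarily [cscal c *: x]. *)
HB.mixin Record isLatticeNormedModule (R : realType) (A : comCStarAlgType R) E
    of GRing.Lmodule A E := {
  lnorm : E -> A;
  lnorm_pos : forall x, pos_cone (lnorm x);
  lnorm_eq0 : forall x, lnorm x = 0 <-> x = 0;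
  lnormZ : forall (a : A) x, lnorm (a *: x) = modulus a * lnorm x;
  lnormD : forall x y, cle (lnorm (x + y)) (lnorm x + lnorm y)
}.

#[short(type="latticeNormedModType")]
HB.structure Definition LatticeNormedModule (R : realType)
    (A : comCStarAlgType R) :=
  {E of GRing.Lmodule A E & isLatticeNormedModule R A E}.

HB.mixin Record isPreHilbertModule (R : realType) (A : comCStarAlgType R) E
    of LatticeNormedModule R A E := {
  inner : E -> E -> A;
  inner_linearl : forall (a : A) (x y z : E),
    inner (a *: x + y) z = a * inner x z + inner y z;
  inner_semilinearr : forall (a : A) (x y z : E),
    inner x (a *: y + z) = star a * inner x y + inner x z;
  inner_lnorm : forall x : E, inner x x = lnorm x ^+ 2
}.

#[short(type="preHilbertModType")]
HB.structure Definition PreHilbertModule (R : realType)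
    (A : comCStarAlgType R) :=
  {E of LatticeNormedModule R A E & isPreHilbertModule R A E}.

Record directedSet := DirectedSet {
  dcarrier :> Type;
  dle : dcarrier -> dcarrier -> Prop;
  dle_refl : forall i, dle i i;
  dle_trans : forall i j k, dle i j -> dle j k -> dle i k;
  dle_ub : forall i j, exists2 k, dle i k & dle j k;
  dle_inhabited : exists i : dcarrier, True
}.

Section ProductDirectedSet.
Variables I J : directedSet.

Definition prod_dle (p q : I * J) : Prop := dle p.1 q.1 /\ dle p.2 q.2.

Fact prod_dle_refl p : prod_dle p p.
Proof. by split; exact: dle_refl. Qed.

Fact prod_dle_trans p q r : prod_dle p q -> prod_dle q r -> prod_dle p r.
Proof.
move=> [pq1 pq2] [qr1 qr2].
by split; [exact: dle_trans qr1 | exact: dle_trans qr2].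
Qed.

Fact prod_dle_ub p q : exists2 r, prod_dle p r & prod_dle q r.
Proof.
have [k1 pk1 qk1] := dle_ub p.1 q.1; have [k2 pk2 qk2] := dle_ub p.2 q.2.
by exists (k1, k2).
Qed.

Fact prod_dle_inhabited : exists p : I * J, True.
Proof.
by have [i _] := dle_inhabited I; have [j _] := dle_inhabited J; exists (i, j).
Qed.

Definition prod_directedSet : directedSet :=
  DirectedSet prod_dle_refl prod_dle_trans prod_dle_ub prod_dle_inhabited.

End ProductDirectedSet.

Definition decreases_to0 (R : realType) (A : comCStarAlgType R)
    (I : directedSet) (u : I -> A) : Prop :=
  [/\ forall i, pos_cone (u i),
      forall i j, dle i j -> cle (u j) (u i) &
      is_inf (range u) 0].

(* These notions depend on the lattice norm only, which is passed explicitly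
   as [p : E -> A], so that they apply both to a lattice-normed module
   ([p := lnorm]) and to the algebra itself ([p := modulus]). *)
Section LatticeNorm.
Context {R : realType} {A : comCStarAlgType R} {E : zmodType} (p : E -> A).
Implicit Types (M F : set E) (l : E).

Definition order_cvg (I : directedSet) (x : I -> E) l : Prop :=
  exists (J : directedSet) (u : J -> A), decreases_to0 u /\
    forall j, exists i0, forall i, dle i0 i -> cle (p (x i - l)) (u j).

Definition order_bounded M : Prop :=
  exists2 f : A, pos_cone f & forall x, M x -> cle (p x) f.

(* The infimum of the empty set does not exist when [A] is nonzero, so an
   empty [F] is only possible for an empty [M]. *)
Definition order_net_bound M F (b : A) : Prop :=
  forall x, M x -> exists2 g, is_inf [set p (x - y) | y in F] g & cle g b.

Definition totally_order_bounded M : Prop :=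
  exists (I : directedSet) (u : I -> A), decreases_to0 u /\
    forall i, exists2 F, finite_set F & order_net_bound M F (u i).

Definition uniformly_totally_order_bounded M : Prop :=
  forall eps : R, 0 < eps ->
    exists2 F, finite_set F & order_net_bound M F (cscal (eps%:C)%C).

End LatticeNorm.

Section Completeness.
Context {R : realType} {A : comCStarAlgType R} {E : zmodType} (p : E -> A).

Definition order_cauchy (I : directedSet) (x : I -> E) : Prop :=
  order_cvg (@modulus R A)
    (fun ij : prod_directedSet I I => p (x ij.1 - x ij.2)) 0.

Definition order_complete : Prop :=
  forall (I : directedSet) (x : I -> E),
    order_cauchy x -> exists l, order_cvg p x l.

End Completeness.

Definition kaplansky_hilbert (R : realType) (A : comCStarAlgType R)
    (E : preHilbertModType A) : Prop :=
  stone_algebra A /\ order_complete (@lnorm R A E).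

Definition finite_rank (R : realType) (A : comCStarAlgType R)
    (E : preHilbertModType A) : Prop :=
  exists (d : nat) (e : 'I_d -> E),
    [/\ forall i j, i != j -> inner (e i) (e j) = 0,
        forall j, lnorm (e j) * lnorm (e j) = lnorm (e j) &
        forall x, x = \sum_(j < d) inner x (e j) *: e j].

(* Main.v *)
Require Import Defs.
From HB Require Import structures.
From mathcomp Require Import all_boot all_order all_algebra.
From mathcomp Require Import complex.
From mathcomp Require Import boolp classical_sets cardinality reals.
From mathcomp Require Import ring lra.

Set Implicit Arguments.
Unset Strict Implicit.
Unset Printing Implicit Defensive.

Import Order.TTheory GRing.Theory Num.Theory.

Local Open Scope classical_set_scope.
Local Open Scope ring_scope.

(* No Gelfand representation is used: the order is controlled by norms, since a
   self-adjoint [a] is positive iff [cnorm (rscal t - a) <= t] for some real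
   [t].  Square roots come from the iteration [z |-> (x + z^2) / 2] for
   [1 - sqrt (1 - x)], which gives that the positive elements form a closed
   cone and that [modulus a] is the least upper bound of [a] and [- a] for
   self-adjoint [a].
     The ball is covered by a finite grid of complex scalars: if [g] is below
   [modulus (f - t)] for every [t] of a real [eps]-grid spanning a
   self-adjoint [f], then [g <= eps]; the complex case follows from
   [modulus (h + i k) <= modulus h + modulus k].
     In finite rank, Parseval's identity bounds the coordinates of an
   order-bounded set in norm, and combinations of grid points form the net.
   Conversely, the triangle inequality bounds [lnorm x] by the sum of the
   [lnorm y] over any finite net, plus its precision. *)

(** * Involution, real scalars and norm *)

Section Star.
Context {R : realType} {A : comCStarAlgType R}.
Implicit Types a b : A.

Fact star_is_zmod_morphism : zmod_morphism (@star R A).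
Proof.
by move=> a b; apply: (addIr (star b)); rewrite -starD !subrK.
Qed.

Fact star_is_monoid_morphism : monoid_morphism (@star R A).
Proof.
split=> [|a b]; last by rewrite starM mulrC.
by rewrite -[1](rmorph1 (@cscal R A)) star_cscal conjc1.
Qed.

HB.instance Definition _ :=
  GRing.isZmodMorphism.Build A A (@star R A) star_is_zmod_morphism.
HB.instance Definition _ :=
  GRing.isMonoidMorphism.Build A A (@star R A) star_is_monoid_morphism.

Definition rscal (t : R) : A := cscal t%:C%C.

HB.instance Definition _ :=
  GRing.RMorphism.copy rscal (@cscal R A \o real_complex R).

Definition iscal : A := cscal 'i%C.

Lemma star_rscal t : star (rscal t) = rscal t.
Proof. by rewrite /rscal star_cscal conjc_real. Qed.

Lemma star_iscal : star iscal = - iscal.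
Proof.
rewrite /iscal star_cscal -rmorphN; congr (cscal _).
by apply/eqP; rewrite eq_complex /= oppr0 !eqxx.
Qed.

Lemma iscal_sqr : iscal ^+ 2 = -1.
Proof. by rewrite /iscal -rmorphXn sqr_i rmorphN1. Qed.

Lemma rscalVK t : t != 0 -> rscal t * rscal t^-1 = 1.
Proof. by move=> t0; rewrite -rmorphM divff// rmorph1. Qed.

Lemma half_rscal : rscal 2^-1 * 2 = 1.
Proof. by rewrite -(rmorph_nat rscal) -rmorphM mulVf ?rmorph1// pnatr_eq0. Qed.

Lemma cnorm_rscal t a : cnorm (rscal t * a) = `|t| * cnorm a.
Proof. by rewrite cnormZ /Normc.normc /= expr0n addr0 sqrtr_sqr. Qed.

Lemma cnorm0 : cnorm (0 : A) = 0.
Proof. by rewrite -(mul0r 0) -(rmorph0 rscal) cnorm_rscal normr0 mul0r. Qed.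

Lemma cnormN a : cnorm (- a) = cnorm a.
Proof.
by rewrite -mulN1r -(rmorphN1 rscal) cnorm_rscal normrN1 mul1r.
Qed.

Lemma cnorm_ge0 a : 0 <= cnorm a.
Proof.
have := cnormD a (- a); rewrite subrr cnorm0 cnormN; lra.
Qed.

Lemma cnormB a b : cnorm (a - b) <= cnorm a + cnorm b.
Proof. by rewrite -(cnormN b) cnormD. Qed.

(** The C*-identity makes [cnorm 1] equal to its own square. The value 0 occurs in the zero algebra,
    hence an inequality. *)
Lemma cnorm1_le1 : cnorm (1 : A) <= 1.
Proof.
have := cnorm_star (1 : A); rewrite rmorph1 mulr1 => h.
have := cnorm_ge0 1; nra.
Qed.

Lemma cnorm_rscal_le t : cnorm (rscal t) <= `|t|.
Proof. by rewrite -[rscal t]mulr1 cnorm_rscal ler_piMr// cnorm1_le1. Qed.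

Lemma cnorm_star_le a : cnorm a <= cnorm (star a).
Proof.
have := cnormM (star a) a; rewrite cnorm_star.
have := cnorm_ge0 a; have := cnorm_ge0 (star a); nra.
Qed.

Lemma cnorm_starE a : cnorm (star a) = cnorm a.
Proof.
apply/eqP; rewrite eq_le cnorm_star_le andbT.
by have := cnorm_star_le (star a); rewrite starK.
Qed.

Lemma cnorm_sqr a : star a = a -> cnorm (a ^+ 2) = cnorm a ^+ 2.
Proof. by move=> sa; rewrite -cnorm_star sa. Qed.

Lemma cnorm_le_eps a b :
  (forall e : R, 0 < e -> cnorm (a - b) <= e) -> a = b.
Proof.
move=> h; apply/eqP; rewrite -subr_eq0; apply/eqP; apply: cnorm_eq0.
apply/eqP; rewrite eq_le cnorm_ge0 andbT.
by apply/ler_addgt0Pr => e e0; rewrite add0r h.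
Qed.

End Star.

(** * Square roots and inverses by majorized iteration *)

Section MajorizedFixpoint.
Context {R : realType} {A : comCStarAlgType R}.

(* Kantorovich's majorant principle: the iteration of [T] from [0] is
   dominated by that of the real function [phi]. *)
Lemma majorized_fixpoint (T : A -> A) (phi : R -> R) (C K : R) :
    (forall t, 0 <= t <= C -> 0 <= phi t <= C) ->
    0 <= C -> 0 <= K ->
    (forall s t, 0 <= t <= s -> s <= C -> phi s - phi t <= K * (s - t)) ->
    cnorm (T 0) <= phi 0 ->
    (forall u v s t, 0 <= t <= s -> s <= C -> cnorm u <= s -> cnorm v <= t ->
      cnorm (u - v) <= s - t -> cnorm (T u - T v) <= phi s - phi t) ->
    (forall u, star u = u -> star (T u) = T u) ->
  exists l : A, [/\ T l = l, cnorm l <= C & star l = l].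
Proof.
move=> phiC C0 K0 phiK T0 Tphi Tsa.
pose z n := iter n T 0; pose r n := iter n phi 0.
have r01 n : 0 <= r n <= C.
  by elim: n => [|n IH]; [rewrite /= lexx C0 | exact: phiC].
have key n : [/\ r n <= r n.+1, cnorm (z n) <= r n &
                cnorm (z n.+1 - z n) <= r n.+1 - r n].
  elim: n => [|n [IH1 IH2 IH3]].
    rewrite /z /r /= !subr0 cnorm0; split => //.
    by have /andP[] := phiC 0 (r01 0).
  have /andP[rn0 rnC] := r01 n; have /andP[rm0 rmC] := r01 n.+1.
  have IH2' : cnorm (z n.+1) <= r n.+1.
    rewrite -[z n.+1](subrK (z n)); apply: le_trans (cnormD _ _) _; lra.
  have st : cnorm (z n.+2 - z n.+1) <= r n.+2 - r n.+1.
    by apply: Tphi => //; rewrite rn0.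
  split => //; rewrite -subr_ge0; exact: le_trans (cnorm_ge0 _) st.
have zr n k : cnorm (z (n + k)%N - z n) <= r (n + k)%N - r n.
  elim: k => [|k IH]; first by rewrite addn0 !subrr cnorm0.
  have [_ _ h] := key (n + k)%N; rewrite addnS.
  have -> : z (n + k).+1 - z n = (z (n + k).+1 - z (n + k)%N) + (z (n + k)%N - z n).
    by ring.
  apply: le_trans (cnormD _ _) _; lra.
have rmono n k : r n <= r (n + k)%N.
  by rewrite -subr_ge0; exact: le_trans (cnorm_ge0 _) (zr n k).
have supr : has_sup (range r).
  split; first by exists (r 0%N), 0%N.
  by exists C => _ [n _ <-]; have /andP[] := r01 n.
(* The limit of the increasing sequence [r]. The gap [rho - r n] bounds the distance from [z n] to
   all later iterates, and so to their limit. *)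
pose rho := sup (range r).
have rrho n : r n <= rho by apply: sup_upper_bound => //; exists n.
have rhoC : rho <= C.
  by apply: sup_le_ub; [exact: supr.1 | move=> _ [n _ <-]; have /andP[] := r01 n].
have near e : 0 < e -> exists N, forall k, rho - e < r (N + k)%N.
  move=> e0; have [_ [N _ <-] hN] := sup_adherent e0 supr.
  by exists N => k; exact: lt_le_trans hN (rmono _ _).
have [|l hl] := @cnorm_complete R A z.
  move=> e e0; have [|N hN] := near (e / 2); first lra.
  exists N => m n /subnKC <- /subnKC <-.
  have := zr N (m - N)%N; have := zr N (n - N)%N.
  have := rrho (N + (m - N))%N; have := rrho (N + (n - N))%N.
  have := hN 0%N; rewrite addn0.
  set zm := z (N + (m - N))%N; set zn := z (N + (n - N))%N.
  move=> h1 h2 h3 h4 h5.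
  have -> : zm - zn = (zm - z N) - (zn - z N) by ring.
  apply: le_lt_trans (cnormB _ _) _; lra.
have zl n : cnorm (l - z n) <= rho - r n.
  apply/ler_addgt0Pr => e e0; have [N hN] := hl e e0.
  have := hN (n + N)%N (leq_addl _ _); have := zr n N; have := rrho (n + N)%N.
  move=> h1 h2 h3.
  have -> : l - z n = (z (n + N)%N - z n) - (z (n + N)%N - l).
    by ring.
  apply: le_trans (cnormB _ _) _; lra.
have rho0 : 0 <= rho by have := rrho 0%N; have /andP[] := r01 0%N; lra.
have lrho : cnorm l <= rho by have := zl 0%N; rewrite /z /r /= !subr0.
exists l; split; [|exact: le_trans lrho rhoC|].
- apply: cnorm_le_eps => e e0.
  (* The two errors below are at most [K] times and once this precision, which add up to [e]. *)
  have [|N hN] := near (e / (K + 1)); first by rewrite divr_gt0//; lra.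
  have h0 := hN 0%N; have h1 := hN 1%N; rewrite addn0 in h0; rewrite addn1 in h1.
  have /andP[rn0 rnC] := r01 N.
  have [_ zN _] := key N.
  have hT : cnorm (T l - T (z N)) <= phi rho - phi (r N).
    by apply: Tphi => //; rewrite rn0 rrho.
  have := phiK rho (r N); rewrite rn0 rrho => /(_ isT rhoC) hK.
  have -> : T l - l = (T l - T (z N)) - (l - z N.+1).
    by rewrite /z /= -/(z N); ring.
  apply: le_trans (cnormB _ _) _.
  have := zl N.+1 => hz.
  have hd : K * (rho - r N) <= K * (e / (K + 1)) by apply: ler_wpM2l => //; lra.
  have -> : e = K * (e / (K + 1)) + e / (K + 1).
    by field; rewrite gt_eqF//; lra.
  lra.
- have saz n : star (z n) = z n.
    by elim: n => [|n IH]; [rewrite /= rmorph0 | exact: Tsa].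
  apply: cnorm_le_eps => e e0.
  have [|N hN] := near (e / 2); first lra.
  have h0 := hN 0%N; rewrite addn0 in h0; have := zl N => hz.
  have -> : star l - l = star (l - z N) - (l - z N).
    by rewrite rmorphB /= saz; ring.
  apply: le_trans (cnormB _ _) _; rewrite cnorm_starE; lra.
Qed.

(** For [y = 1 - z] the equation becomes [z = (x + z ^+ 2) / 2]. Its majorant [(1 + t ^+ 2) / 2]
    maps [0, 1] to itself with Lipschitz constant 1. The bound on [1 - y] later shows that the root
    is positive. *)
Lemma one_sub_sqr (x : A) : star x = x -> cnorm x <= 1 ->
  exists y : A, [/\ star y = y, 1 - x = y ^+ 2 & cnorm (1 - y) <= 1].
Proof.
move=> sx nx.
have [|||||||z [zE z1 sz]] :=
  @majorized_fixpoint (fun z => rscal 2^-1 * (x + z ^+ 2))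
    (fun t => 2^-1 * (1 + t ^+ 2)) 1 1.
- by move=> t /andP[t0 t1]; apply/andP; split; nra.
- by [].
- by [].
- by move=> s t /andP[t0 ts] s1; nra.
- rewrite expr0n /= !addr0 cnorm_rscal ger0_norm ?invr_ge0//; lra.
- move=> u v s t /andP[t0 ts] s1 us vt uv.
  have -> : rscal 2^-1 * (x + u ^+ 2) - rscal 2^-1 * (x + v ^+ 2)
          = rscal 2^-1 * ((u - v) * (u + v)) :> A by ring.
  rewrite cnorm_rscal ger0_norm ?invr_ge0//.
  have := cnormM (u - v) (u + v); have := cnormD u v.
  have := cnorm_ge0 (u - v); have := cnorm_ge0 (u + v) => h1 h2 h3 h4.
  have : cnorm (u - v) * cnorm (u + v) <= (s - t) * (s + t).
    by apply: ler_pM => //; lra.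
  lra.
- by move=> u su; rewrite rmorphM rmorphD rmorphXn /= star_rscal sx su.
exists (1 - z); split; first by rewrite rmorphB rmorph1 /= sz.
- have hh := @half_rscal R A.
  have xE : x + z ^+ 2 = z * 2 by rewrite -{2}zE; ring: hh.
  by rewrite -[x](addrK (z ^+ 2)) xE; ring.
- by rewrite opprB addrC subrK.
Qed.

(** The Neumann series: the inverse is [1 + z] with [z = x * (1 + z)]. The bound [q / (1 - q)] is
    the fixed point of the majorant, as [cE] records. *)
Lemma one_sub_inv (x : A) : star x = x -> cnorm x < 1 ->
  exists y : A, (1 - x) * y = 1.
Proof.
move=> sx nx; have x0 := cnorm_ge0 x; set q := cnorm x in nx x0.
have q1 : 1 - q != 0 by rewrite gt_eqF//; lra.
have cE : q * (1 + q / (1 - q)) = q / (1 - q) by field.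
have [|||||||z [zE _ _]] :=
  @majorized_fixpoint (fun z => x * (1 + z)) (fun t => q * (1 + t)) (q / (1 - q)) q.
- move=> t /andP[t0 tC]; apply/andP; split; first nra.
  by rewrite -[leRHS]cE ler_wpM2l//; lra.
- by rewrite divr_ge0//; lra.
- by [].
- by move=> s t _ _; nra.
- by rewrite !addr0 !mulr1.
- move=> u v s t _ _ _ _ uv.
  have -> : x * (1 + u) - x * (1 + v) = x * (u - v) by ring.
  apply: le_trans (cnormM _ _) _; rewrite -/q.
  have : q * cnorm (u - v) <= q * (s - t) by rewrite ler_wpM2l.
  lra.
- by move=> u su; rewrite rmorphM rmorphD rmorph1 /= sx su.
exists (1 + z); rewrite mulrBl mul1r zE; ring.
Qed.

End MajorizedFixpoint.

(** * The positive cone and its order *)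

Section Cone.
Context {R : realType} {A : comCStarAlgType R}.
Implicit Types (a b c h k y z : A) (s t e : R).

Lemma cartesian_decomposition b : exists h k,
  [/\ star h = h, star k = k, b = h + iscal * k & star b * b = h ^+ 2 + k ^+ 2].
Proof.
have hh := @half_rscal R A; have ii := @iscal_sqr R A.
exists (rscal 2^-1 * (b + star b)), (rscal 2^-1 * iscal * (star b - b)).
split.
- by rewrite rmorphM rmorphD /= star_rscal starK addrC.
- rewrite !rmorphM rmorphB /= star_rscal star_iscal starK; ring.
- rewrite (_ : iscal * _ = iscal ^+ 2 * rscal 2^-1 * (star b - b)); last by ring.
  by rewrite ii; ring: hh.
- rewrite (_ : (rscal 2^-1 * iscal * (star b - b)) ^+ 2 =
    iscal ^+ 2 * rscal 2^-1 ^+ 2 * (star b - b) ^+ 2); last by ring.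
  have hh2 : rscal 2^-1 ^+ 2 * 4 = 1 :> A.
    by transitivity ((rscal 2^-1 * 2 : A) ^+ 2); [ring | rewrite hh expr1n].
  by rewrite ii; ring: hh2.
Qed.

(** [h] is the real part of [w = h + i k], so its norm is at most that of [w], while [star w * w] is
    the sum of squares. This is the source of the monotonicity of the norm on the cone. *)
Lemma cnorm_le_add_sqr h k : star h = h -> star k = k ->
  cnorm h ^+ 2 <= cnorm (h ^+ 2 + k ^+ 2).
Proof.
move=> sh sk; pose w := h + iscal * k.
have sw : star w = h - iscal * k.
  by rewrite rmorphD rmorphM /= sh sk star_iscal mulNr.
have ww : star w * w = h ^+ 2 + k ^+ 2.
  rewrite sw /w (_ : _ * _ = h ^+ 2 - iscal ^+ 2 * k ^+ 2); last by ring.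
  by rewrite iscal_sqr; ring.
rewrite -ww cnorm_star lerXn2r ?nnegrE ?cnorm_ge0//.
have -> : h = rscal 2^-1 * (w + star w).
  have hh := @half_rscal R A; rewrite sw /w; ring: hh.
rewrite cnorm_rscal ger0_norm ?invr_ge0//.
have := cnormD w (star w); rewrite cnorm_starE; lra.
Qed.

(** Scaling by the square root of [t] reduces to [t = 1]. There [1 - g ^+ 2] is a square [y ^+ 2],
    and [y ^+ 2 + g ^+ 2 = 1] bounds its norm. If [t <= 0], both [h] and [t] vanish. *)
Lemma cnorm_rscal_sub_sqr h t : star h = h -> cnorm h ^+ 2 <= t ->
  cnorm (rscal t - h ^+ 2) <= t.
Proof.
move=> sh ht; have h0 := cnorm_ge0 h.
have [t0|t0] := leP t 0.
  have n0 : cnorm h = 0 by nra.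
  have {}t0 : t = 0 by apply/eqP; rewrite eq_le t0 /=; nra.
  by rewrite (cnorm_eq0 _ n0) t0 rmorph0 expr0n subr0 cnorm0.
pose s := Num.sqrt t; have s0 : 0 < s by rewrite sqrtr_gt0.
have sst : s ^+ 2 = t by rewrite sqr_sqrtr// ltW.
pose g := rscal s^-1 * h : A.
have sg : star g = g by rewrite rmorphM /= star_rscal sh.
have gE : h = rscal s * g by rewrite mulrA rscalVK ?mul1r// gt_eqF.
have g1 : cnorm g ^+ 2 <= 1.
  rewrite cnorm_rscal gtr0_norm ?invr_gt0// exprMn exprVn sst.
  by rewrite ler_pdivrMl// mulr1.
have [||y [sy yE _]] := @one_sub_sqr R A (g ^+ 2).
- by rewrite rmorphXn /= sg.
- by rewrite cnorm_sqr.
have -> : rscal t - h ^+ 2 = rscal t * y ^+ 2.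
  by rewrite gE -sst -yE; ring.
rewrite cnorm_rscal gtr0_norm// ler_piMr ?(ltW t0)// cnorm_sqr//.
apply: le_trans (cnorm_le_add_sqr sy sg) _.
by rewrite -yE subrK cnorm1_le1.
Qed.

(** Apply [one_sub_sqr] to [x = (t - a) / t], for which [a = t (1 - x)]. The last clause has the
    form of the hypothesis on [a], so that the root is itself positive by [pos_near]. *)
Lemma near_sqrt a t : star a = a -> cnorm (rscal t - a) <= t ->
  exists y, [/\ star y = y, y ^+ 2 = a & exists s, cnorm (rscal s - y) <= s].
Proof.
move=> sa nt; have := le_trans (cnorm_ge0 _) nt.
rewrite le_eqVlt => /predU1P[t0|t0].
  exists 0; split; first exact: rmorph0.
    move: nt; rewrite -t0 rmorph0 sub0r cnormN => na.
    rewrite expr0n; apply/esym/cnorm_eq0/eqP.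
    by rewrite eq_le na cnorm_ge0.
  by exists 0; rewrite rmorph0 subr0 cnorm0.
have tE := @rscalVK R A t (lt0r_neq0 t0).
have [||y [sy yE y1]] := @one_sub_sqr R A (rscal t^-1 * (rscal t - a)).
- by rewrite rmorphM rmorphB /= !star_rscal sa.
- by rewrite cnorm_rscal gtr0_norm ?invr_gt0// ler_pdivrMl// mulr1.
pose s := Num.sqrt t.
have sst : s ^+ 2 = t by rewrite sqr_sqrtr// ltW.
exists (rscal s * y); split.
- by rewrite rmorphM /= star_rscal sy.
- by rewrite exprMn -rmorphXn /= sst -yE; ring: tE.
- exists s; rewrite -{1}[rscal s]mulr1 -mulrBr cnorm_rscal ger0_norm ?sqrtr_ge0//.
  by rewrite ler_piMr ?sqrtr_ge0.
Qed.

Lemma pos_near a t : star a = a -> cnorm (rscal t - a) <= t -> pos_cone a.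
Proof. by move=> sa /near_sqrt[]// y [sy <- _]; exists y; rewrite sy. Qed.

Lemma pos_selfadjoint a : pos_cone a -> star a = a.
Proof. by move=> [b ->]; rewrite rmorphM /= starK mulrC. Qed.

Lemma pos_exists_sqrt a : pos_cone a ->
  exists y, [/\ star y = y, y ^+ 2 = a & exists s, cnorm (rscal s - y) <= s].
Proof.
move=> [b ->].
have [h [k [sh sk _ bE]]] := cartesian_decomposition b.
apply: (@near_sqrt _ (cnorm h ^+ 2 + cnorm k ^+ 2)).
  by rewrite rmorphM /= starK mulrC.
have -> : rscal (cnorm h ^+ 2 + cnorm k ^+ 2) - star b * b =
    (rscal (cnorm h ^+ 2) - h ^+ 2) + (rscal (cnorm k ^+ 2) - k ^+ 2).
  by rewrite bE; ring.
apply: le_trans (cnormD _ _) _.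
by apply: lerD; apply: cnorm_rscal_sub_sqr.
Qed.

(** With [pos_near], this turns positivity into a norm inequality, available for every [t] above the
    norm. *)
Lemma pos_norm_near a t : pos_cone a -> cnorm a <= t ->
  cnorm (rscal t - a) <= t.
Proof.
move=> /pos_exists_sqrt[y [sy <- _]]; rewrite cnorm_sqr//.
exact: cnorm_rscal_sub_sqr.
Qed.

Lemma pos_sqrt a : pos_cone a -> exists2 y, pos_cone y & y ^+ 2 = a.
Proof.
move=> /pos_exists_sqrt[y [sy yE [s ys]]].
by exists y => //; exact: pos_near ys.
Qed.

Lemma pos_sqr y : star y = y -> pos_cone (y ^+ 2).
Proof. by move=> sy; exists y; rewrite sy. Qed.

(** The norm criterion is additive in the pair [(t, a)], by the triangle inequality. *)
Lemma posD a b : pos_cone a -> pos_cone b -> pos_cone (a + b).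
Proof.
move=> pa pb; apply: (@pos_near _ (cnorm a + cnorm b)).
  by rewrite rmorphD /= !pos_selfadjoint.
have -> : rscal (cnorm a + cnorm b) - (a + b) =
    (rscal (cnorm a) - a) + (rscal (cnorm b) - b) by ring.
apply: le_trans (cnormD _ _) _.
by apply: lerD; apply: pos_norm_near.
Qed.

Lemma posM a b : pos_cone a -> pos_cone b -> pos_cone (a * b).
Proof. by move=> [x ->] [y ->]; exists (x * y); rewrite rmorphM /=; ring. Qed.

Lemma pos_rscal t : 0 <= t -> pos_cone (rscal t : A).
Proof.
move=> t0; rewrite -(sqr_sqrtr t0) rmorphXn; apply: pos_sqr; exact: star_rscal.
Qed.

Lemma pos0 : pos_cone (0 : A).
Proof. by rewrite -(rmorph0 rscal); exact: pos_rscal. Qed.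

Lemma pos_sum (I : finType) (F : I -> A) :
  (forall i, pos_cone (F i)) -> pos_cone (\sum_i F i).
Proof. by move=> h; elim/big_ind: _ => //; [exact: pos0 | exact: posD]. Qed.

(** The criterion for [a + e] at radius [cnorm a + e] gives the one for [a] at radius [cnorm a] up
    to an error [e], which tends to 0. *)
Lemma pos_archimedean a : star a = a ->
  (forall e, 0 < e -> pos_cone (a + rscal e)) -> pos_cone a.
Proof.
move=> sa h; apply: (@pos_near _ (cnorm a)) => //.
apply/ler_addgt0Pr => e e0; have p := h e e0.
have -> : rscal (cnorm a) - a = rscal (cnorm a + e) - (a + rscal e) by ring.
apply: pos_norm_near => //; apply: le_trans (cnormD _ _) _.
by rewrite lerD2l; apply: le_trans (cnorm_rscal_le _) _; rewrite gtr0_norm.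
Qed.

Lemma cnorm_le a b : pos_cone a -> cle a b -> cnorm a <= cnorm b.
Proof.
move=> /pos_exists_sqrt[y [sy yE _]] /pos_exists_sqrt[z [sz zE _]].
have -> : b = y ^+ 2 + z ^+ 2 by rewrite yE zE; ring.
by rewrite -yE cnorm_sqr//; exact: cnorm_le_add_sqr.
Qed.

Lemma cle_norm a t : star a = a -> cnorm a <= t -> cle a (rscal t).
Proof.
move=> sa at_; apply: (@pos_near _ t); first by rewrite rmorphB /= star_rscal sa.
by rewrite opprB addrC subrK.
Qed.

Lemma clexx a : cle a a.
Proof. by rewrite /cle subrr; exact: pos0. Qed.

Lemma cle_trans b a c : cle a b -> cle b c -> cle a c.
Proof. by move=> ab bc; rewrite /cle -(subrKA b); exact: posD. Qed.

Lemma cleD a b c d : cle a b -> cle c d -> cle (a + c) (b + d).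
Proof. by move=> ab cd; rewrite /cle opprD addrACA; exact: posD. Qed.

Lemma cle_sum (I : finType) (F G : I -> A) :
  (forall i, cle (F i) (G i)) -> cle (\sum_i F i) (\sum_i G i).
Proof. by move=> h; rewrite /cle -sumrB; exact: pos_sum. Qed.

Lemma cle_rscal s t : s <= t -> cle (rscal s : A) (rscal t).
Proof. by move=> st; rewrite /cle -rmorphB; apply: pos_rscal; rewrite subr_ge0. Qed.

(** Being at least [e], [s] is invertible: [s = t (1 - x)] where [x] has norm at most
    [T / (T + e) < 1]. *)
Lemma pos_of_mul (s d : A) e : 0 < e -> pos_cone (s - rscal e) -> star d = d ->
  pos_cone (d * s) -> pos_cone d.
Proof.
move=> e0 pse sd pds.
pose T := cnorm (s - rscal e); have T0 : 0 <= T := cnorm_ge0 _.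
pose t := T + e; have t0 : 0 < t by rewrite /t; lra.
have ps : pos_cone s by rewrite -[s](subrK (rscal e)); apply: posD => //; exact/pos_rscal/ltW.
pose x := rscal t^-1 * (rscal t - s).
have tE := @rscalVK R A t (lt0r_neq0 t0).
have [||v vE] := @one_sub_inv R A x.
- by rewrite rmorphM rmorphB /= !star_rscal (pos_selfadjoint ps).
- rewrite cnorm_rscal gtr0_norm ?invr_gt0// ltr_pdivrMl// mulr1.
  have -> : rscal t - s = rscal T - (s - rscal e) by rewrite /t; ring.
  by apply: le_lt_trans (pos_norm_near pse (lexx _)) _; rewrite /t -/T; lra.
pose w := rscal t^-1 * v.
have sw : s * w = 1.
  by rewrite -[RHS]vE /x /w; ring: tE.
have sw' : s * star w = 1.
  by rewrite -{1}(pos_selfadjoint ps) -rmorphM /= sw rmorph1.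
(* The factors [d * s], [w * star w] and [s] are all positive, which bypasses a proof that the
   inverse [w] is positive. *)
have -> : d = d * s * (star (star w) * star w) * s.
  rewrite starK; transitivity (d * (s * w) * (s * star w)); last by ring.
  by rewrite sw sw' !mulr1.
by apply: posM => //; apply: posM => //; exists (star w).
Qed.

(* With [p = c - b] and [q = c^2 - b^2] one has [2 c p = p^2 + q], so that
   [(p + e) (2 c + e)] is positive for every [e > 0]; [2 c + e] can then be
   cancelled.  Positivity of [b] is not assumed, whence [b <= modulus b]. *)
Lemma pos_sub_of_sqr c b : pos_cone c -> star b = b ->
  pos_cone (c ^+ 2 - b ^+ 2) -> cle b c.
Proof.
move=> pc sb pq; have sc := pos_selfadjoint pc.
apply: pos_archimedean => [|e e0]; first by rewrite rmorphB /= sb sc.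
apply: (@pos_of_mul (2 * c + rscal e) _ e) => //.
- rewrite addrK mulr_natl mulr2n; exact: posD.
- by rewrite rmorphD rmorphB /= star_rscal sb sc.
have -> : (c - b + rscal e) * (2 * c + rscal e) =
    (c ^+ 2 - b ^+ 2) + (c - b + rscal (e / 2)) ^+ 2 + rscal (2 * e) * c
    + rscal (e ^+ 2 * 3 / 4).
  (* All scalars become polynomials in [e / 2], leaving an identity without division. *)
  have -> : rscal e = rscal (e / 2) * 2 :> A.
    by rewrite -(rmorph_nat rscal) -rmorphM; congr rscal; field.
  have -> : rscal (2 * e) = rscal (e / 2) * 4 :> A.
    by rewrite -(rmorph_nat rscal) -rmorphM; congr rscal; field.
  have -> : rscal (e ^+ 2 * 3 / 4) = rscal (e / 2) ^+ 2 * 3 :> A.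
    by rewrite -rmorphXn -(rmorph_nat rscal) -rmorphM; congr rscal; field.
  by move: (rscal (e / 2)) => u; ring.
apply: posD; last by apply: pos_rscal; nra.
apply: posD; last by apply: posM => //; apply: pos_rscal; lra.
apply: posD => //; apply: pos_sqr.
by rewrite rmorphD rmorphB /= star_rscal sb sc.
Qed.

End Cone.

(** * The modulus and finite grids of scalars *)

Section Modulus.
Context {R : realType} {A : comCStarAlgType R}.
Implicit Types a c f g h p q : A.

Lemma modulusP a : pos_cone (modulus a) /\ modulus a ^+ 2 = star a * a.
Proof.
have [|y py yE] := @pos_sqrt R A (star a * a); first by exists a.
by apply: (@xgetPex _ 0 [set b | pos_cone b /\ b ^+ 2 = star a * a]); exists y.
Qed.

Lemma modulus_pos a : pos_cone (modulus a).
Proof. by case: (modulusP a). Qed.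

Lemma modulus_sqr a : modulus a ^+ 2 = star a * a.
Proof. by case: (modulusP a). Qed.

Lemma modulus_sqr_selfadjoint a : star a = a -> modulus a ^+ 2 = a ^+ 2.
Proof. by move=> sa; rewrite modulus_sqr sa. Qed.

Lemma cnorm_modulus a : cnorm (modulus a) = cnorm a.
Proof.
apply/eqP; rewrite -(@eqrXn2 _ 2) ?cnorm_ge0//.
by rewrite -cnorm_sqr ?modulus_sqr ?cnorm_star// pos_selfadjoint//; exact: modulus_pos.
Qed.

Lemma cle_modulus a : star a = a -> cle a (modulus a).
Proof.
move=> sa; apply: pos_sub_of_sqr => //; first exact: modulus_pos.
by rewrite modulus_sqr_selfadjoint// subrr; exact: pos0.
Qed.

Lemma cle_modulusN a : star a = a -> cle (- a) (modulus a).
Proof.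
move=> sa; apply: pos_sub_of_sqr; first exact: modulus_pos.
  by rewrite rmorphN /= sa.
by rewrite modulus_sqr_selfadjoint// sqrrN subrr; exact: pos0.
Qed.

Lemma modulus_le a c : pos_cone c -> star a = a -> cle a c -> cle (- a) c ->
  cle (modulus a) c.
Proof.
move=> pc sa ac nac; apply: pos_sub_of_sqr => //.
  exact/pos_selfadjoint/modulus_pos.
rewrite modulus_sqr_selfadjoint// (_ : _ - _ = (c - a) * (c - - a)); last by ring.
exact: posM.
Qed.

(** Since the square of the left side is [h ^+ 2 + k ^+ 2], the two squares differ by twice
    [modulus h * modulus k]. *)
Lemma modulus_cartesian h (k : A) : star h = h -> star k = k ->
  cle (modulus (h + iscal * k)) (modulus h + modulus k).
Proof.
move=> sh sk; have ph := modulus_pos h; have pk := modulus_pos k.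
apply: pos_sub_of_sqr; [exact: posD|exact/pos_selfadjoint/modulus_pos|].
rewrite modulus_sqr rmorphD rmorphM /= star_iscal sh sk.
rewrite (_ : _ - _ = (modulus h ^+ 2 - h ^+ 2) + (modulus k ^+ 2 - k ^+ 2)
  + (modulus h * modulus k + modulus h * modulus k) + (iscal ^+ 2 + 1) * k ^+ 2);
  last by ring.
rewrite !modulus_sqr_selfadjoint// iscal_sqr !subrr addNr mul0r addr0 !add0r.
by apply: posD; exact: posM.
Qed.

(** As [p * q = 0], the square of [(p - h) + (q - h)] exceeds that of [p + q] by
    [4 (p - h) (q - h)], which is positive. Taking roots leaves [- 2 h] positive. *)
Lemma cle_disjoint p q h : pos_cone p -> pos_cone q -> p * q = 0 ->
  cle h p -> cle h q -> cle h 0.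
Proof.
move=> pp pq pq0 hp hq.
have ppq := posD pp pq.
have : cle (p + q) ((p - h) + (q - h)).
  apply: pos_sub_of_sqr; [exact: posD|exact: pos_selfadjoint|].
  have -> : (p - h + (q - h)) ^+ 2 - (p + q) ^+ 2 =
      2 ^+ 2 * ((p - h) * (q - h)) - 4 * (p * q) by ring.
  rewrite pq0 mulr0 subr0; apply: posM; last exact: posM.
  by apply: pos_sqr; rewrite rmorph_nat.
rewrite /cle (_ : _ - _ = 2 * (0 - h)); last by ring.
move=> h2; rewrite -[0 - h]mul1r -half_rscal -mulrA.
by apply: posM => //; apply: pos_rscal; rewrite invr_ge0.
Qed.

(** As [k] runs from 0 to [2 N], these points go from [- N eps] to [N eps] in steps of [eps]. *)
Definition grid_point (eps : R) (N k : nat) : R := (k%:R - N%:R) * eps.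

(** For functions this is pointwise: each value of [f] is within [eps] of a grid point. The
    order-theoretic substitute is an induction along the grid, passing each point by a disjointness
    argument. *)
Lemma cle_real_grid f g (eps : R) (N : nat) : 0 < eps -> star f = f ->
    cnorm f <= N%:R * eps ->
    (forall k : nat, (k <= N + N)%N -> cle g (modulus (f - rscal (grid_point eps N k)))) ->
  cle g (rscal eps).
Proof.
move=> e0 sf fN gk; pose t := grid_point eps N.
have pe : pos_cone (rscal eps : A) by exact/pos_rscal/ltW.
have sft k : star (f - rscal (t k)) = f - rscal (t k).
  by rewrite rmorphB /= star_rscal sf.
(* [g] lies below the join of [eps] and [f - t n]; quantifying over upper
   bounds [c] avoids forming that join. *)
have key n : (n <= N + N)%N -> forall c, cle (rscal eps) c ->
    cle (f - rscal (t n)) c -> cle g c.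
  elim: n => [|n IH] nN c ec fc.
    (* The first grid point [- N eps] is below [f], so [f - t 0] is positive and dominates its own
       modulus. *)
    have pf : pos_cone (f - rscal (t 0%N)).
      have := @cle_norm R A (- f) (N%:R * eps).
      rewrite rmorphN /= sf cnormN => /(_ erefl fN).
      by rewrite /cle opprK /t /grid_point sub0r mulNr rmorphN opprK addrC.
    apply: (cle_trans (gk 0%N _)) => //.
    have pc : pos_cone c by rewrite -[c](subrK (rscal eps)); exact: posD.
    apply: modulus_le => //; apply: (@cle_trans _ _ 0).
      by rewrite /cle sub0r opprK.
    by rewrite /cle subr0.
  (* Here [f - t n = a + eps], so the induction hypothesis applies to the upper bound [eps + m + a].
     Hence [g - c] is below both [m + a] and [m - a], whose product is 0. *)
  pose a := f - rscal (t n.+1); pose m := modulus a.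
  have sa : star a = a := sft n.+1.
  have pm1 : pos_cone (m - a) := cle_modulus sa.
  have pm2 : pos_cone (m + a) by rewrite -[a]opprK; exact: cle_modulusN.
  have pm : pos_cone m := modulus_pos a.
  have gm : cle g m := gk _ nN.
  have ge : cle g (rscal eps + (m + a)).
    apply: IH; first exact: ltnW.
      by rewrite /cle addrAC subrr add0r.
    rewrite /cle (_ : _ - _ = m) //.
    rewrite /a /t /grid_point -natr1; ring.
  have : cle (g - c) 0.
    apply: (@cle_disjoint (m + a) (m - a)) => //.
    - rewrite (_ : _ * _ = m ^+ 2 - a ^+ 2); last by ring.
      by rewrite modulus_sqr_selfadjoint// subrr.
    - rewrite /cle (_ : _ - _ = (rscal eps + (m + a) - g) + (c - rscal eps));
        last by ring.
      exact: posD.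
    - rewrite /cle (_ : _ - _ = (m - g) + (c - a)); last by ring.
      exact: posD.
  by rewrite /cle sub0r opprB.
(* The last grid point [N eps] is above [f], so [c = eps] is an admissible upper bound. *)
apply: (key (N + N)%N) => //; first exact: clexx.
apply: (@cle_trans _ _ 0); last by rewrite /cle subr0.
have := @cle_norm R A f (N%:R * eps) sf fN.
rewrite /cle (_ : t (N + N)%N = N%:R * eps); first by rewrite sub0r opprB.
by rewrite /t /grid_point natrD addrK.
Qed.

(** Real and imaginary parts each get a grid of mesh [eps / 2]. Speaking of lower bounds [g] avoids
    infima, and [i0] witnesses that the net is nonempty. *)
Lemma ball_net (C eps : R) : 0 < eps ->
  exists (I : finType) (i0 : I) (y : I -> A), forall f, cnorm f <= C ->
    forall g, (forall i, cle g (modulus (f - y i))) -> cle g (rscal eps).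
Proof.
move=> e0; pose d := eps / 2; have d0 : 0 < d by rewrite /d; lra.
pose N := Num.bound (`|C| / d).
have CN : C <= N%:R * d.
  apply: le_trans (ler_norm _) _; rewrite -ler_pdivrMr//.
  by apply/ltW/archi_boundP; rewrite divr_ge0// ltW.
pose I : finType := ('I_(N + N).+1 * 'I_(N + N).+1)%type.
pose t (k : nat) := rscal (grid_point d N k) : A.
exists I, (ord0, ord0), (fun i : I => t i.1 + iscal * t i.2) => f fC g gf.
have [h [k [sh sk fE ffE]]] := cartesian_decomposition f.
have nh : cnorm h <= N%:R * d.
  apply: le_trans CN; apply: le_trans fC.
  rewrite -(@ler_pXn2r _ 2) ?nnegrE ?cnorm_ge0// -(cnorm_star f) ffE.
  exact: cnorm_le_add_sqr.
have nk : cnorm k <= N%:R * d.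
  apply: le_trans CN; apply: le_trans fC.
  rewrite -(@ler_pXn2r _ 2) ?nnegrE ?cnorm_ge0// -(cnorm_star f) ffE addrC.
  exact: cnorm_le_add_sqr.
have st a n : star a = a -> star (a - t n) = a - t n.
  by move=> sa; rewrite rmorphB /= star_rscal sa.
have gt (i j : nat) : (i <= N + N)%N -> (j <= N + N)%N ->
    cle g (modulus (h - t i) + modulus (k - t j)).
  move=> iN jN.
  apply: cle_trans (gf (Ordinal (iN : (i < (N + N).+1)%N),
    Ordinal (jN : (j < (N + N).+1)%N))) _ => /=.
  have -> : f - (t i + iscal * t j) = (h - t i) + iscal * (k - t j).
    by rewrite fE; ring.
  by apply: modulus_cartesian; exact: st.
(* For fixed [j], the grid lemma in the variable [i] removes the real part; a second use in [j]
   removes the imaginary part. *)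
have gj j : (j <= N + N)%N -> cle (g - modulus (k - t j)) (rscal d).
  move=> jN; apply: (@cle_real_grid h _ d N) => // i iN.
  by have := gt i j iN jN; rewrite /cle opprB addrA.
have : cle (g - rscal d) (rscal d).
  apply: (@cle_real_grid k _ d N) => // j jN.
  by have := gj j jN; rewrite /cle !opprB addrCA.
have -> : rscal eps = rscal d + rscal d :> A.
  by rewrite -rmorphD; congr rscal; rewrite /d; field.
by rewrite /cle opprB addrA.
Qed.

End Modulus.

(** * Infima in a Stone algebra and nets decreasing to 0 *)

Section Infima.
Context {R : realType} {A : comCStarAlgType R}.

Lemma stone_exists_inf (S : set A) (b : A) : stone_algebra A ->
    S `<=` selfadjoint -> S !=set0 -> selfadjoint b ->
    (forall a, S a -> cle b a) ->
  exists g, is_inf S g.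
Proof.
move=> stoneA Ssa [a0 Sa0] sb Sb.
have cleN (x y : A) : cle x y -> cle (- y) (- x) by rewrite /cle opprK addrC.
have [|||g [sg gub glub]] := stoneA [set a | S (- a)].
- by move=> a /Ssa; rewrite /selfadjoint/= rmorphN/= => /oppr_inj.
- by exists (- a0); rewrite /= opprK.
- exists (- b); first by rewrite /selfadjoint/= rmorphN/= sb.
  by move=> a /Sb /cleN; rewrite opprK.
exists (- g); split.
- by rewrite /selfadjoint/= rmorphN/= sg.
- by move=> a Sa; rewrite -[a]opprK; apply/cleN/gub; rewrite /= opprK.
- move=> c sc cS; rewrite -[c]opprK; apply/cleN/glub.
    by rewrite /selfadjoint/= rmorphN/= sc.
  by move=> a /cS /cleN; rewrite opprK.
Qed.

(** The distances to a nonempty [F] are bounded below by 0, so their infimum exists; being itself a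
    lower bound, it falls under the hypothesis on [g]. *)
Lemma order_net_boundP (E : zmodType) (p : E -> A) (M F : set E) (b : A) :
    stone_algebra A -> (forall x, pos_cone (p x)) -> F !=set0 ->
    (forall x, M x -> forall g, (forall y, F y -> cle g (p (x - y))) -> cle g b) ->
  order_net_bound p M F b.
Proof.
move=> stoneA pp [y0 Fy0] MF x Mx.
have [||||g ginf] := @stone_exists_inf [set p (x - y) | y in F] 0 stoneA.
- by move=> _ [y _ <-]; exact: pos_selfadjoint.
- by exists (p (x - y0)), y0.
- by rewrite /selfadjoint/= rmorph0.
- by move=> _ [y _ <-]; rewrite /cle subr0.
exists g => //; apply: (MF x Mx) => y Fy.
by case: ginf => _ + _; apply; exists y.
Qed.

(** The net [1 / (n + 1)] consists of positive real scalars, at which a uniform hypothesis can be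
    evaluated. Its infimum is 0 by [pos_archimedean]. *)
Lemma decreases_to0_harmonic : exists (I : directedSet) (u : I -> A),
  decreases_to0 u /\ forall i, exists2 t : R, 0 < t & u i = rscal t.
Proof.
have leT i j k : (i <= j)%N -> (j <= k)%N -> (i <= k)%N by exact: leq_trans.
have leU i j : exists2 k, (i <= k)%N & (j <= k)%N.
  by exists (maxn i j); [exact: leq_maxl | exact: leq_maxr].
pose I := DirectedSet leqnn leT leU (ex_intro _ 0%N Logic.I).
pose t (n : nat) : R := n.+1%:R^-1.
have t0 n : 0 < t n by rewrite invr_gt0.
exists I, (fun n : nat => rscal (t n)); split; last by move=> n; exists (t n).
split.
- by move=> n; exact/pos_rscal/ltW.
- move=> m n mn; apply: cle_rscal.
  by rewrite lef_pV2 ?posrE// ler_nat ltnS.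
- split; first exact: rmorph0.
    by move=> _ [n _ <-]; rewrite /cle subr0; exact/pos_rscal/ltW.
  move=> b sb bt; rewrite /cle sub0r; apply: pos_archimedean => [|e e0].
    by rewrite rmorphN /= sb.
  pose n := Num.bound e^-1.
  have ne : t n <= e.
    rewrite -[leRHS]invrK lef_pV2 ?posrE ?invr_gt0//.
    apply: le_trans (ltW (archi_boundP _)) _; first by rewrite invr_ge0 ltW.
    by rewrite ler_nat.
  rewrite addrC; apply: cle_trans (cle_rscal ne).
  by apply: bt; exists n.
Qed.

Lemma pos_le_sum_seq (E : eqType) (p : E -> A) (s : seq E) y :
  (forall x, pos_cone (p x)) -> y \in s -> cle (p y) (\sum_(x <- s) p x).
Proof.
move=> pp; have ps (s' : seq E) : pos_cone (\sum_(x <- s') p x).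
  by elim/big_ind: _ => //; [exact: pos0 | exact: posD].
elim: s => [//|z s IH]; rewrite inE big_cons => /predU1P[->|/IH ys].
  by rewrite /cle addrAC subrr add0r.
by rewrite /cle -addrA; exact: posD.
Qed.

End Infima.

(** * From uniform total boundedness down to order-boundedness *)

Section Equivalences.
Context {R : realType} {A : comCStarAlgType R} {E : latticeNormedModType A}.
Implicit Types M : set E.

(** One index [i] suffices: [lnorm x - B] is a self-adjoint lower bound of the distances from [x] to
    the net, hence below their infimum and below [u i]. *)
Lemma totally_order_bounded_order_bounded M :
  totally_order_bounded (@lnorm R A E) M -> order_bounded (@lnorm R A E) M.
Proof.
move=> [I [u [[upos _ _] netu]]]; have [i _] := dle_inhabited I.
have [F /finite_seqP[s ->] Fnet] := netu i.
pose B := \sum_(y <- s) lnorm y : A.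
have pB : pos_cone B.
  by rewrite /B; elim/big_ind: _ => [||y _];
    [exact: pos0 | exact: posD | exact: lnorm_pos].
exists (u i + B); first exact: posD.
move=> x Mx; have [g [sg _ gglb] gu] := Fnet x Mx.
have : cle (lnorm x - B) g.
  apply: gglb.
    by rewrite /selfadjoint/= rmorphB /= !pos_selfadjoint//; exact: lnorm_pos.
  move=> _ [y ys <-].
  have h1 := lnormD (x - y) y; rewrite subrK in h1.
  have h2 : cle (lnorm y) B by apply: pos_le_sum_seq => // z; exact: lnorm_pos.
  rewrite /cle (_ : _ - _ = (lnorm (x - y) + lnorm y - lnorm x) + (B - lnorm y));
    last by ring.
  exact: posD.
by move=> /cle_trans/(_ gu); rewrite /cle opprB addrA.
Qed.

Lemma uniformly_totally_order_bounded_totally M :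
  uniformly_totally_order_bounded (@lnorm R A E) M ->
  totally_order_bounded (@lnorm R A E) M.
Proof.
move=> uM; have [I [u [u0 ut]]] := @decreases_to0_harmonic R A.
by exists I, u; split=> // i; have [t t0 ->] := ut i; exact: uM.
Qed.

End Equivalences.

(** * Coordinates and finite nets in finite rank *)

Section FiniteRank.
Context {R : realType} {A : comCStarAlgType R} {E : preHilbertModType A}.

Lemma inner0r (z : E) : inner z 0 = 0.
Proof.
have := inner_semilinearr 1 z (0 : E) 0.
by rewrite scale1r addr0 rmorph1 mul1r => /esym/eqP; rewrite -subr_eq0 addrK => /eqP.
Qed.

Lemma inner_sumr (I : finType) (c : I -> A) (e : I -> E) z :
  inner z (\sum_i c i *: e i) = \sum_i star (c i) * inner z (e i).
Proof.
elim: (index_enum I) => [|i s IH]; first by rewrite !big_nil inner0r.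
by rewrite !big_cons inner_semilinearr IH.
Qed.

Lemma lnorm_sum (I : finType) (x : I -> E) :
  cle (lnorm (\sum_i x i)) (\sum_i lnorm (x i)).
Proof.
elim: (index_enum I) => [|i s IH].
  by rewrite !big_nil (lnorm_eq0 _).2//; exact: clexx.
rewrite !big_cons; apply: cle_trans (lnormD _ _) _.
by apply: cleD => //; exact: clexx.
Qed.

Lemma pos_idempotent_le1 (p : A) : star p = p -> p * p = p -> cle p 1.
Proof.
move=> sp pp; rewrite /cle (_ : 1 - p = (1 - p) ^+ 2); last by ring: pp.
by apply: pos_sqr; rewrite rmorphB rmorph1 /= sp.
Qed.

Section Basis.
Context (d : nat) (e : 'I_d -> E).
Hypothesis e_idem : forall j, lnorm (e j) * lnorm (e j) = lnorm (e j).
Hypothesis e_span : forall x, x = \sum_(j < d) inner x (e j) *: e j.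

(** Only the second argument of [inner x x] is expanded. *)
Lemma parseval x :
  lnorm x ^+ 2 = \sum_j star (inner x (e j)) * inner x (e j).
Proof. by rewrite -inner_lnorm {2}(e_span x) inner_sumr. Qed.

Lemma cnorm_coord x j : cnorm (inner x (e j)) <= cnorm (lnorm x).
Proof.
rewrite -(@ler_pXn2r _ 2) ?nnegrE ?cnorm_ge0// -cnorm_star.
rewrite -cnorm_sqr; last exact/pos_selfadjoint/lnorm_pos.
apply: cnorm_le; first by exists (inner x (e j)).
rewrite parseval (bigD1 j)//= /cle addrAC subrr add0r.
by elim/big_ind: _ => [||i _]; [exact: pos0|exact: posD|exists (inner x (e i))].
Qed.

Lemma lnorm_sub_comb x (c : 'I_d -> A) :
  cle (lnorm (x - \sum_j c j *: e j)) (\sum_j modulus (inner x (e j) - c j)).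
Proof.
rewrite {1}(e_span x) -sumrB.
under eq_bigr do rewrite -scalerBl.
apply: cle_trans (lnorm_sum _) _; apply: cle_sum => j; rewrite lnormZ.
rewrite /cle -[X in X - _]mulr1 -mulrBr; apply: posM; first exact: modulus_pos.
by apply: pos_idempotent_le1 => //; exact/pos_selfadjoint/lnorm_pos.
Qed.

End Basis.

(** The infimum over all choice functions [phi] is bounded one coordinate at a time, by induction on
    [d]. *)
Lemma cle_sum_net (I : Type) (d : nat) (m : 'I_d -> I -> A) (b : A) :
    (forall j g, (forall i, cle g (m j i)) -> cle g b) ->
  forall g, (forall phi : 'I_d -> I, cle g (\sum_j m j (phi j))) ->
    cle g (b *+ d).
Proof.
elim: d m => [|d IH] m mb g gphi.
  (* For [d = 0] the empty function is a choice even if [I] is empty. *)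
  by have := gphi (fun i => False_rect I (notF (ltn_ord i))); rewrite big_ord0.
rewrite mulrS.
have : cle (g - b) (b *+ d).
  apply: (IH (fun j => m (lift ord0 j))) => [j|phi]; first exact: mb.
  have : cle (g - \sum_j m (lift ord0 j) (phi j)) b.
    apply: (mb ord0) => i.
    (* This choice takes the value [i] at [ord0] and follows [phi] on the remaining coordinates. *)
    have := gphi (fun j => oapp phi i (unlift ord0 j)).
    rewrite big_ord_recl unlift_none /=.
    under eq_bigr do rewrite liftK /=.
    by rewrite /cle opprB addrA.
  by rewrite /cle !opprB addrCA.
by rewrite /cle opprB addrCA addrA.
Qed.

Lemma order_bounded_uniformly_totally (M : set E) :
    stone_algebra A -> finite_rank E -> order_bounded (@lnorm R A E) M ->
  uniformly_totally_order_bounded (@lnorm R A E) M.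
Proof.
move=> stoneA [d [e [_ e_idem e_span]]] [f pf Mf] eps eps0.
(* The [d] coordinates together cost [d t <= eps]; the successor keeps the denominator nonzero when
   [d = 0]. *)
pose t := eps / d.+1%:R.
have t0 : 0 < t by rewrite divr_gt0.
have [I [i0 [y ynet]]] := @ball_net R A (cnorm f) t t0.
pose z (phi : {ffun 'I_d -> I}) : E := \sum_j y (phi j) *: e j.
exists (z @` setT); first exact/finite_image/finite_finset.
apply: order_net_boundP => //; first exact: lnorm_pos.
  by exists (z [ffun=> i0]), [ffun=> i0].
move=> x Mx g gz.
apply: (@cle_trans _ _ (rscal t *+ d)).
  apply: (@cle_sum_net _ _ (fun j i => modulus (inner x (e j) - y i))).
    move=> j; apply: (ynet (inner x (e j))).
    apply: le_trans (cnorm_coord e_span x j) _.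
    by apply: cnorm_le; [exact: lnorm_pos | exact: Mf].
  move=> phi.
  have zI : range z (z [ffun j => phi j]) by exists [ffun j => phi j].
  apply: cle_trans (gz _ zI) _.
  apply: cle_trans (lnorm_sub_comb e_idem e_span _ _) _.
  under eq_bigr do rewrite ffunE.
  exact: clexx.
rewrite -rmorphMn; apply: cle_rscal.
by rewrite /t -mulr_natr mulrAC ler_pdivrMr// ler_wpM2l ?ler_nat// ltW.
Qed.

End FiniteRank.

(** * The unit ball and the cycle of implications *)

Lemma unit_ball_uniformly_totally (R : realType) (A : comCStarAlgType R) :
  stone_algebra A ->
  uniformly_totally_order_bounded (@modulus R A) [set f : A | cle (modulus f) 1].
Proof.
move=> stoneA eps eps0.
have [I [i0 [y ynet]]] := @ball_net R A 1 eps eps0.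
exists (y @` setT); first exact/finite_image/finite_finset.
apply: order_net_boundP => //; first exact: modulus_pos.
  by exists (y i0), i0.
move=> f /= f1 g gy; apply: (ynet f) => [|i]; last by apply: gy; exists i.
rewrite -cnorm_modulus; apply: le_trans (cnorm_le (modulus_pos f) f1) _.
exact: cnorm1_le1.
Qed.


Theorem proposition2p5 (R : realType) (A : comCStarAlgType R)
    (stoneA : stone_algebra A) :
  uniformly_totally_order_bounded (@modulus R A)
    [set f : A | cle (modulus f) 1] /\
  forall E : preHilbertModType A,
    kaplansky_hilbert E -> finite_rank E ->
    forall M : set E,
      (order_bounded (@lnorm R A E) M
         <-> totally_order_bounded (@lnorm R A E) M) /\
      (totally_order_bounded (@lnorm R A E) M
         <-> uniformly_totally_order_bounded (@lnorm R A E) M).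
Proof.
split; first exact: unit_ball_uniformly_totally.
move=> E _ rankE M.
have i_iii := @order_bounded_uniformly_totally R A E M stoneA rankE.
have iii_ii := @uniformly_totally_order_bounded_totally R A E M.
have ii_i := @totally_order_bounded_order_bounded R A E M.
by split; split=> // h; [exact/iii_ii/i_iii | exact/i_iii/ii_i].
Qed.
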